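(* Assume the weak diamond $\Phi^2_{\omega_1}$. Then for every $\aleph_1$-tree $T$ with no uncountable antichains and every ladder system $\mathbf C$ on $\omega_1$, there is a monochromatic $2$-colouring of $\mathbf C$ which has no $T$-uniformization.
   Context: A tree is a partial order $(T,<)$ in which the set $t^{\downarrow}=\{s:s<t\}$ of predecessors of each $t$ is well ordered; $\mathrm{ht}(t)$ is the order type of $t^\downarrow$, $T_\alpha$ is the set of nodes of height $\alpha$, and for $\xi<\mathrm{ht}(s)$, $s\upharpoonright\xi$ denotes the unique predecessor of $s$ of height $\xi$. An $\aleph_1$-tree is a tree of height $\omega_1$ with all levels countable. A ladder system is a sequence $\mathbf C=(C_\alpha)_{\alpha\in\lim(\omega_1)}$ indexed by countable limit ordinals with $C_\alpha$ a cofinal subset of $\alpha$ of order type $\omega$. A $2$-colouring of $\mathbf C$ is a sequence $(f_\alpha)$ with $f_\alpha:C_\alpha\to 2$; it is monochromatic if each $f_\alpha$ is constant. A subtree of a tree $T$ of height $\omega_1$ is a downward closed $S\subseteq T$ such that every $s\in S$ has extensions in $S$ of arbitrarily large height below $\omega_1$. A $T$-uniformization of $\mathbf f$ is a map $\varphi$ defined on a subtree $S\subseteq T$ such that for every $s\in S$ of limit height $\alpha$ and all but finitely many $\xi\in C_\alpha$, $\varphi(s\upharpoonright\xi)=f_\alpha(\xi)$. $\Phi^2_{\omega_1}$ is the statement: for every $F:2^{<\omega_1}\to 2$ there is $g\in 2^{\omega_1}$ such that for every $f\in 2^{\omega_1}$ the set $\{\alpha<\omega_1: g(\alpha)\neq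 F(f\upharpoonright\alpha)\}$ is stationary.
   Formalization: Subtrees are required to be nonempty; with the literal definition the empty set is a subtree and the empty map would be a T-uniformization of every colouring, making the claim false. *)

(* Defs.v *)
From HB Require Import structures.
From mathcomp Require Import all_boot all_order.
From mathcomp Require Import boolp classical_sets functions cardinality.

Set Implicit Arguments.
Unset Strict Implicit.
Unset Printing Implicit Defensive.

Import Order.TTheory.
Local Open Scope classical_set_scope.
Local Open Scope order_scope.

Definition down (d : Order.disp_t) (P : porderType d) (t : P) : set P :=
  [set s | s < t].

Definition well_ordered (d : Order.disp_t) (P : porderType d) (A : set P) : Prop :=
  forall B : set P, B `<=` A -> B !=set0 ->
    exists2 m, B m & forall x, B x -> m <= x.

Definition order_iso (d d' : Order.disp_t) (P : porderType d) (Q : porderType d')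
    (A : set P) (B : set Q) : Prop :=
  exists f : P -> Q, {in A &, {mono f : x y / x <= y}} /\ f @` A = B.

(* omega_1 as the first uncountable well-order; this determines W up to order
   isomorphism, and the elements of W play the role of the countable ordinals,
   with [down a] the ordinal a itself. *)
Definition is_omega1 (d : Order.disp_t) (W : orderType d) : Prop :=
  [/\ well_ordered [set: W],
      ~ countable [set: W]
    & forall a : W, countable (down a)].

Definition is_limit (d : Order.disp_t) (W : orderType d) (a : W) : Prop :=
  down a !=set0 /\ forall b, b < a -> exists2 c, b < c & c < a.

Definition club (d : Order.disp_t) (W : orderType d) (D : set W) : Prop :=
  (forall a, exists2 b, D b & a < b) /\
  (forall a, is_limit a ->
     (forall b, b < a -> exists c, [/\ D c, b < c & c < a]) -> D a).

Definition stationary (d : Order.disp_t) (W : orderType d) (X : set W) : Prop :=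
  forall D : set W, club D -> (X `&` D) !=set0.

(* 2^{<omega_1}: a length a together with a function a -> 2. *)
Definition binseq (d : Order.disp_t) (W : orderType d) : Type :=
  {a : W & {x : W | x < a} -> bool}.

Definition cut (d : Order.disp_t) (W : orderType d) (f : W -> bool) (a : W) :
    binseq W :=
  existT (fun a : W => {x : W | x < a} -> bool) a (fun x => f (sval x)).

Definition weak_diamond (d : Order.disp_t) (W : orderType d) : Prop :=
  forall F : binseq W -> bool, exists g : W -> bool, forall f : W -> bool,
    stationary [set a | g a <> F (cut f a)].

Definition is_tree (d : Order.disp_t) (T : porderType d) : Prop :=
  forall t : T, well_ordered (down t).

(* T_a, i.e. the nodes t such that the order type of [down t] is a. *)
Definition level (dW dT : Order.disp_t) (W : orderType dW) (T : porderType dT)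
    (a : W) : set T :=
  [set t | order_iso (down t) (down a)].
Arguments level {dW dT W} T a _.

(* The first two conditions after [is_tree] say that T has height omega_1: every
   node has countable height and no level below omega_1 is empty. *)
Definition aleph1_tree (dW dT : Order.disp_t) (W : orderType dW)
    (T : porderType dT) : Prop :=
  [/\ is_tree T,
      forall t : T, exists a : W, level T a t,
      forall a : W, level T a !=set0
    & forall a : W, countable (level T a)].

Definition antichain (d : Order.disp_t) (T : porderType d) (A : set T) : Prop :=
  forall x y, A x -> A y -> x <> y -> ~~ (x >=< y).

(* s|xi; it takes the junk value s when xi is not below the height of s. *)
Definition restr (dW dT : Order.disp_t) (W : orderType dW) (T : porderType dT)
    (s : T) (xi : W) : T :=
  xget s [set r | r < s /\ level T xi r].

(* Subtrees are required to be nonempty: otherwise the empty map would be a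
   T-uniformization of every colouring. *)
Definition subtree (dW dT : Order.disp_t) (W : orderType dW) (T : porderType dT)
    (S : set T) : Prop :=
  [/\ S !=set0,
      forall s t, S t -> s < t -> S s
    & forall s, S s -> forall a : W,
        exists t, [/\ S t, s <= t & exists2 b : W, a <= b & level T b t]].

(* Only the values C a at limit a are meaningful. *)
Definition ladder_system (d : Order.disp_t) (W : orderType d) (C : W -> set W) :
    Prop :=
  forall a, is_limit a ->
    [/\ C a `<=` down a,
        forall b, b < a -> exists2 c, C a c & b <= c
      & order_iso [set: nat] (C a)].

(* A 2-colouring of C is given by f : W -> W -> bool, of which only the values
   f a xi with a limit and xi in C a are meaningful. *)
Definition monochromatic (d : Order.disp_t) (W : orderType d) (C : W -> set W)
    (f : W -> W -> bool) : Prop :=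
  forall a, is_limit a -> exists i : bool, forall xi, C a xi -> f a xi = i.

(* phi is the uniformizing map; its values outside the subtree S are ignored. *)
Definition uniformization (dW dT : Order.disp_t) (W : orderType dW)
    (T : porderType dT) (C : W -> set W) (f : W -> W -> bool)
    (S : set T) (phi : T -> bool) : Prop :=
  subtree W S /\
  forall (s : T) (a : W), S s -> is_limit a -> level T a s ->
    finite_set [set xi | C a xi /\ phi (restr s xi) <> f a xi].

(* Main.v *)
(** A subtree [S] of a tree without uncountable antichains is determined, at all
    sufficiently high levels, by what lies below: the minimal nodes of the
    complement of [S] form an antichain, so they are bounded in height, and above
    that bound a node belongs to [S] as soon as all its
    predecessors do.  Code [S] and [phi] by a single [f : W -> bool].  For a club
    of [a], the restriction of [f] to [a] decodes [S] and [phi] below level [a],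
    hence knows which nodes of level [a] are in [S].  Let [F] ask whether
    [phi (s|xi)] is true for almost all [xi] in [C a], for some such node [s].
    If [phi] uniformizes the colouring with constant value [g a] on [C a], then
    [F] returns [g a] on that club, so a [g] provided by the weak diamond for [F]
    gives a colouring that cannot be uniformized. *)
Require Import Defs.
From mathcomp Require Import all_boot all_order.
From mathcomp Require Import boolp classical_sets functions cardinality.

Set Implicit Arguments.
Unset Strict Implicit.
Unset Printing Implicit Defensive.

Import Order.TTheory.
Local Open Scope classical_set_scope.
Local Open Scope order_scope.

Lemma countable_setU (X : Type) (A B : set X) :
  countable A -> countable B -> countable (A `|` B).
Proof.
move=> cA cB.
have cU : countable (\bigcup_(i in [set: bool]) if i then A else B).
  by apply: bigcup_countable => [|[]//]; exact: finite_set_countable.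
apply: card_le_trans cU; apply/subset_card_le => x.
by case; [exists true|exists false].
Qed.

(** * Bounding, coding and closure points in $\omega_1$ *)

Section Omega1.
Context (dW : Order.disp_t) (W : orderType dW) (hW : is_omega1 W).

Lemma omega1_wf : well_founded (fun a b : W => a < b).
Proof.
case: hW => wo _ _ a; apply: contrapT => nAcc.
have [||m /= nm mP] := wo [set x | ~ Acc (fun a b : W => a < b) x] => //.
  by exists a.
apply: nm; constructor => y ym; apply: contrapT => ny.
by have := mP y ny; rewrite leNgt ym.
Qed.

Lemma omega1_countable_le (a : W) : countable [set b | b <= a].
Proof.
have ca : countable (Defs.down a `|` [set a]).
  by apply: countable_setU; [case: hW|exact: countable1].
apply: card_le_trans ca; apply/subset_card_le => b /=.
by rewrite le_eqVlt => /predU1P[->|]; [right|left].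
Qed.

(** Otherwise [W] would be a countable union of countable initial segments. *)
Lemma omega1_bounded (B : set W) : countable B ->
  exists c, forall b, B b -> b < c.
Proof.
case: hW => _ nc _ cB; apply: contrapT => unb; apply: nc.
have cU : countable (\bigcup_(b in B) [set a | a <= b]).
  by apply: bigcup_countable => // b _; exact: omega1_countable_le.
apply: card_le_trans cU.
apply/subset_card_le => a _; apply: contrapT => na; apply: unb; exists a => b Bb.
by rewrite ltNge; apply/negP => ab; apply: na; exists b.
Qed.

(** Serves to code pairs of a node and a bit in [W], with [u] the height. The fibre over [a] is sent
    into a sequence of type $\omega$ starting at [v a]; these blocks are pairwise disjoint. *)
Lemma omega1_inj_countable_fibres (X : Type) (u : X -> W) :
  (forall a, countable [set x | u x = a]) -> exists h : X -> W, injective h.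
Proof.
move=> cu.
have [up upP] : {up : W -> W & forall a, a < up a}.
  apply: (@choice _ _ (fun a b : W => a < b)) => a.
  have [c cP] := omega1_bounded (countable1 a).
  by exists c; exact: cP.
pose it n a := iter n up a.
have it_lt a : {homo it^~ a : m n / (m < n)%N >-> m < n}.
  apply: homo_ltn; first exact: lt_trans.
  by move=> n /=; exact: upP.
have it_inj a : injective (it^~ a).
  move=> m n /= mn; have [/(it_lt a)|/(it_lt a)|//] := ltngtP m n;
  by rewrite mn ltxx.
(* [v] leaves room for a copy of [nat] between any two of its values. *)
have [v vP] : exists v : W -> W, forall a b n, b < a -> it n (v b) < v a.
  have bnd (a : W) (w : forall b, b < a -> W) :
      exists c, forall b (ba : b < a) n, it n (w b ba) < c.
    (* Makes [w] total, so that its values can be indexed by [down a]. *)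
    pose w' b := if pselect (b < a) is left ba then w b ba else b.
    have [|c cP] := @omega1_bounded
        (\bigcup_(b in Defs.down a) range (fun n => it n (w' b))).
      apply: bigcup_countable; first by case: hW.
      by move=> b _; apply: card_le_trans (card_image_le _ _) _.
    exists c => b ba n; apply: cP; exists b => //; exists n => //.
    rewrite /w'; case: pselect => // ba'.
    by rewrite (Prop_irrelevance ba ba').
  pose step a w := projT1 (cid (bnd a w)).
  exists (Fix omega1_wf (fun=> W) step) => a b n ba.
  rewrite [X in _ < X]Fix_eq; last first.
    move=> x f g fg; congr step.
    by apply: functional_extensionality_dep => y; apply: funext => yx; exact: fg.
  by rewrite {2}/step; case: cid => c /= /(_ b ba n).
have [e eP] : {e : W -> X -> nat & forall a,
    {in [set x | u x = a] &, injective (e a)}}.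
  apply: (@choice _ _ (fun a (e : X -> nat) =>
    {in [set x | u x = a] &, injective e})) => a.
  exact/countable_injP.
exists (fun x => it (e (u x) x) (v (u x))) => x y /= exy.
have uxy : u x = u y.
  have [uxy|uyx|//] := ltgtP (u x) (u y).
    have := vP _ _ (e (u x) x) uxy; rewrite exy ltNge.
    by case: (e (u y) y) => [|n]; rewrite ?lexx // (ltW (it_lt _ 0 n.+1 _)).
  have := vP _ _ (e (u y) y) uyx; rewrite -exy ltNge.
  by case: (e (u x) x) => [|n]; rewrite ?lexx // (ltW (it_lt _ 0 n.+1 _)).
move: exy; rewrite uxy => /it_inj; by apply: eP; rewrite inE.
Qed.

Lemma club_closed_under (k : W -> set W) (c : W) :
  (forall a, countable (k a)) ->
  club [set a | [/\ is_limit a, c < a & forall b x, b < a -> k b x -> x < a]].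
Proof.
move=> ck; split=> [a|a la aP]; last first.
  split=> //.
    have [b ba] := la.1; have [x [[_ cx _] _ xa]] := aP b ba.
    exact: lt_trans xa.
  move=> b x ba kx; have [y [[_ _ yP] bY ya]] := aP b ba.
  exact: lt_trans (yP _ _ bY kx) ya.
have [next nextP] : {next : W -> W & forall a, a < next a /\
    forall b x, b <= a -> k b x -> x < next a}.
  apply: (@choice _ _ (fun a y : W => a < y /\
    forall b x, b <= a -> k b x -> x < y)) => b.
  have [|y yP] := @omega1_bounded
      ([set b] `|` \bigcup_(z in [set z | z <= b]) k z).
    apply: countable_setU; first exact: countable1.
    by apply: bigcup_countable => //; exact: omega1_countable_le.
  exists y; split; first by apply: yP; left.
  by move=> z x zb kx; apply: yP; right; exists z.
pose it n := iter n next (Order.max a c).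
have [|y yP] := @omega1_bounded (range it).
  by apply: card_le_trans (card_image_le _ _) _.
have [wo _ _] := hW.
(* [m] is the supremum of the strictly increasing iterates, hence a limit; each [b < m] is below
   some [it n], so [k b] is bounded by [it n.+1]. *)
have [||m mP mmin] := wo [set x | forall n, it n < x] => //.
  by exists y => n; apply: yP; exists n.
have below b : b < m -> exists n, b <= it n.
  move=> bm; apply: contrapT => nb; have := mmin b; rewrite leNgt bm => mb.
  suff: false by [].
  by apply: mb => n; rewrite ltNge; apply/negP => bn; apply: nb; exists n.
have := mP 0%N; rewrite /it /= gt_max => /andP[am cm].
exists m => //; split=> //.
- split; first by exists a.
  move=> b /below[n bn]; exists (it n.+1) => //.
  exact: le_lt_trans bn (nextP _).1.
- move=> b x /below[n bn] kx; apply: lt_trans (mP n.+1).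
  exact: (nextP _).2 bn kx.
Qed.

End Omega1.

(** * Heights in trees, and subtrees *)

Section Levels.
Context (dW : Order.disp_t) (W : orderType dW) (hW : is_omega1 W).
Context (dT : Order.disp_t) (T : porderType dT).

(** An isomorphism of [down s] onto [down a] restricts to [down r] for [r < s], so it computes the
    heights of the predecessors of [s]. *)
Lemma level_below (a : W) (s : T) : level T a s ->
  exists f : T -> W, (forall r, r < s -> f r < a /\ level T (f r) r) /\
    (forall b, b < a -> exists2 r, r < s & f r = b).
Proof.
move=> [f [fmono fim]]; exists f; split=> [r rs|b ba]; last first.
  have : Defs.down a b by [].
  by rewrite -fim.
have fa x : x < s -> f x < a.
  move=> xs; have : (f @` Defs.down s) (f x) by exists x.
  by rewrite fim.
have fsub : {in Defs.down s &, {mono f : x y / x < y}} := leW_mono_in fmono.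
split; [exact: fa|exists f; split].
  move=> x y; rewrite !inE /Defs.down /= => xr yr.
  by apply: fmono; rewrite inE; apply: lt_trans rs.
apply/seteqP; split=> [_ [x xr <-]|b bfr] /=.
  by rewrite /Defs.down /= fsub ?inE //; apply: lt_trans rs.
have : Defs.down a b by apply: lt_trans bfr (fa _ rs).
rewrite -fim => -[x xs fx]; exists x => //.
by move: bfr; rewrite /Defs.down /= -fx fsub ?inE.
Qed.

Lemma level_restr (a xi : W) (s : T) : level T a s -> xi < a ->
  restr s xi < s /\ level T xi (restr s xi).
Proof.
move=> /level_below[f [fP fS]] /fS[r rs fr].
apply: (@xgetPex _ s [set r | r < s /\ level T xi r]).
by exists r; split=> //; rewrite -fr; case: (fP r rs).
Qed.

Lemma level_uniq (a b : W) (t : T) : level T a t -> level T b t -> a = b.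
Proof.
wlog ab : a b / a < b.
  move=> H la lb; have [ab|ba|//] := ltgtP a b; first exact: H.
  by apply/esym; exact: H.
move=> [f [fmono fim]] [g [gmono gim]]; exfalso.
have fsub : {in Defs.down t &, {mono f : x y / x < y}} := leW_mono_in fmono.
have gsub : {in Defs.down t &, {mono g : x y / x < y}} := leW_mono_in gmono.
have [wo _ _] := hW.
(* Take the least [g r] with [f r < g r]. Then [f r = g q] with [q < r], so [f q < g q < g r],
   against minimality. *)
have [||m [r rt /= [-> frgr]] mmin] :=
    wo [set x | exists2 r, Defs.down t r & x = g r /\ f r < g r] => //.
  have : Defs.down b a by [].
  rewrite -gim => -[r rt gr]; exists (g r), r => //; split=> //.
  have : (f @` Defs.down t) (f r) by exists r.
  by rewrite fim gr.
have : Defs.down b (f r).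
  have : (f @` Defs.down t) (f r) by exists r.
  by rewrite fim => /lt_trans; apply.
rewrite -gim => -[q qt gq]; have := mmin (g q); rewrite leNgt gq frgr => H.
suff: false by [].
apply: H; exists q => //; split=> //; rewrite gq fsub ?inE //.
by rewrite -gsub ?inE // gq.
Qed.

Lemma subtree_level (S : set T) (a : W) : subtree W S ->
  exists2 s, S s & level T a s.
Proof.
move=> [[s0 Ss0] Sdown Sext].
have [t [St _ [b ab lbt]]] := Sext s0 Ss0 a.
move: ab; rewrite le_eqVlt => /predU1P[->|ab]; first by exists t.
have [rt lr] := level_restr lbt ab.
by exists (restr t a) => //; exact: Sdown rt.
Qed.

Lemma high_level_mem_of_down (S : set T) :
  (forall t : T, exists a : W, level T a t) ->
  (forall A : set T, antichain A -> countable A) ->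
  exists c : W, forall a s, c < a -> level T a s -> Defs.down s `<=` S -> S s.
Proof.
move=> /choice[ht htP] hA.
pose A := [set t | ~ S t /\ Defs.down t `<=` S].
have cA : countable A.
  (* Of two comparable members of [A], the smaller would be a predecessor of the larger, hence in
     [S]. *)
  apply: hA => x y [nSx xS] [nSy yS] xy; apply/negP => /orP[le|le].
    apply: nSx; apply: yS; rewrite /Defs.down /= lt_neqAle le andbT.
    exact/eqP.
  apply: nSy; apply: xS; rewrite /Defs.down /= lt_neqAle le andbT.
  by apply/eqP => /esym.
have [|c cP] := @omega1_bounded _ _ hW (ht @` A).
  exact: card_le_trans (card_image_le _ _) cA.
exists c => a s ca las sS; apply: contrapT => nSs.
have : ht s < c by apply: cP; exists s.
by rewrite (level_uniq (htP s) las) ltNge (ltW ca).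
Qed.

End Levels.

(** * Decoding from initial segments, and the colouring *)

Section Decode.
Context (dW : Order.disp_t) (W : orderType dW).

Definition binseq_on (p : binseq W) (x : W) : Prop :=
  exists xp : x < projT1 p, projT2 p (exist _ x xp).

Lemma binseq_on_cut (f : W -> bool) (a x : W) : x < a ->
  binseq_on (cut f a) x <-> f x.
Proof. by move=> xa; split=> [[]|fx] //; exists xa. Qed.

End Decode.

Lemma ladder_infinite (dW : Order.disp_t) (W : orderType dW) (C : W -> set W)
  (a : W) : ladder_system C -> is_limit a -> ~ finite_set (C a).
Proof.
move=> hC /hC[_ _ [f [fmono <-]]].
have finj : {in [set: nat] &, injective f}.
  by move=> x y xT yT fxy; apply/le_anti; rewrite -!fmono // fxy !lexx.
by rewrite (eq_finite_set (inj_card_eq finj)); exact: infinite_nat.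
Qed.

Theorem mainTheorem1 (dW : Order.disp_t) (W : orderType dW) (hW : is_omega1 W)
    (hPhi : weak_diamond W)
    (dT : Order.disp_t) (T : porderType dT) (hT : aleph1_tree W T)
    (hA : forall A : set T, antichain A -> countable A)
    (C : W -> set W) (hC : ladder_system C) :
  exists f : W -> W -> bool,
    monochromatic C f /\
    ~ (exists (S : set T) (phi : T -> bool), uniformization C f S phi).
Proof.
have [_ hht _ hlev] := hT.
have cnt (a : W) : countable (level T a `*` [set: bool]).
  by apply: countableX => //; exact: finite_set_countable.
have [h hinj] : exists h : T * bool -> W, injective h.
  have [ht htP] := choice hht.
  apply: (@omega1_inj_countable_fibres _ _ hW _ (fun x => ht x.1)) => a.
  apply: card_le_trans (cnt a); apply/subset_card_le => -[t i] /= <-.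
  by split=> //; exact: htP.
(* [h (t, false)] codes [S t] and [h (t, true)] codes [phi t]. *)
pose F (p : binseq W) : bool := `[< exists s, [/\ level T (projT1 p) s,
  forall r, r < s -> binseq_on p (h (r, false)) &
  finite_set [set xi | C (projT1 p) xi /\
    ~ binseq_on p (h (restr s xi, true))]] >].
have [g gP] := hPhi F.
exists (fun a _ => g a); split; first by move=> a _; exists (g a).
move=> [S [phi [hS phiP]]]; have [_ Sdown _] := hS.
have [c cP] := high_level_mem_of_down hW S hht hA.
pose f x := `[< exists t, x = h (t, false) /\ S t \/
                          x = h (t, true) /\ phi t >].
have fS t : f (h (t, false)) <-> S t.
  split=> [/asboolP[u [[/hinj[<-]]|[/hinj]]]//|St].
  by apply/asboolP; exists t; left.
have fphi t : f (h (t, true)) <-> phi t.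
  split=> [/asboolP[u [[/hinj]|[/hinj[<-]]]]//|St].
  by apply/asboolP; exists t; right.
(* [h] sends nodes of height below [a] below [a], so [cut f a] decodes them; [c < a] then settles
   which nodes of level [a] lie in [S]. *)
have [|a [/= gF [la ca hcl]]] := gP f _
    (club_closed_under hW (k := fun a => h @` (level T a `*` [set: bool])) c _).
  by move=> a; apply: card_le_trans (card_image_le _ _) (cnt a).
have hlt s r i : level T a s -> r < s -> h (r, i) < a.
  move=> /level_below[v [vP _]] /vP[va lr].
  by apply: hcl va _; exists (r, i).
have Ca xi : C a xi -> xi < a by case: (hC a la) => + _ _; exact.
have [Sa0 infC] := (subtree_level a hS, ladder_infinite hC la).
have on_phi s xi : level T a s -> C a xi ->
    binseq_on (cut f a) (h (restr s xi, true)) <-> phi (restr s xi).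
  move=> las /Ca xia; rewrite binseq_on_cut ?fphi //.
  by apply: (hlt s) => //; case: (level_restr las xia).
have on_S s : level T a s ->
    (forall r, r < s -> binseq_on (cut f a) (h (r, false))) <-> S s.
  move=> las; split=> [sS|Ss r rs].
    apply: (cP a) => // r rs; apply/fS.
    by rewrite -(binseq_on_cut f (hlt _ _ _ las rs)); exact: sS.
  by rewrite binseq_on_cut ?fS; [exact: Sdown rs|exact: hlt rs].
(* If [g a] is true, any node of [S] at level [a] witnesses [F]. If it is false, a witness would lie
   in [S], and [phi] would be both almost always true and almost always false along the infinite set
   [C a]. *)
apply: gF; have [ga|/negbTE ga] := boolP (g a); apply/esym.
  apply/asboolP; have [s Ss las] := Sa0; exists s; split=> //; first exact/on_S.
  apply: sub_finite_set (phiP s a Ss la las) => xi [/= Cxi nphi].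
  by split=> // phit; apply: nphi; apply/on_phi => //; rewrite phit.
apply/negP => /asboolP[s [/= las /(on_S _ las) Ss fin]]; apply: infC.
apply: sub_finite_set (_ : finite_set (_ `|` _)); last first.
  by rewrite finite_setU; split; [exact: fin|exact: (phiP s a Ss la las)].
move=> xi Cxi; have [phit|phif] := pselect (phi (restr s xi)).
  by right; split=> //; rewrite phit ga.
by left; split=> // on; apply: phif; exact/(on_phi s xi las Cxi).
Qed.
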